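(* Consider the problem $\min_{\mathbf{x},\mathbf{z}}F(\mathbf{x})+H(\mathbf{z})$ subject to $\mathbf{A}\mathbf{x}+\mathbf{B}\mathbf{z}=\mathbf{c}$, with $F=F^0+F^1$ and $H=H^0+H^1$. Suppose that the problem is feasible and its set of stationary points is nonempty; that $F$ and $H$ are bounded from below and coercive, $F^0$ and $H^0$ are differentiable with $L_F$- and $L_H$-Lipschitz gradients ($L_F,L_H>0$), and $F^1$ and $H^1$ are proper, closed, and $\gamma_F$- and $\gamma_H$-weakly convex; and that the parameters $\rho,\beta,\tau_F,\tau_H,d$ satisfy $\rho>0$, $\beta>0$, $0<\rho\beta<1$, $d>\frac{(1-\rho\beta)(2-\rho\beta)}{4\rho\beta}>0$, $\tau_F\mathbf{I}\succ 2d\rho\mathbf{A}^\top\mathbf{A}+[(4d+3)L_F+(4d+1)\gamma_F]\mathbf{I}$, $\tau_H\mathbf{I}\succ 8d\rho\mathbf{B}^\top\mathbf{B}+[(4d+3)L_H+(4d+1)\gamma_H]\mathbf{I}$, $\tau_F\mathbf{I}\succ\rho\mathbf{A}^\top\mathbf{A}$, $\tau_H\mathbf{I}\succ\rho\mathbf{B}^\top\mathbf{B}$, $\tau_F>\gamma_F$, $\tau_H>\gamma_H$. Let $\{(\mathbf{x}^k,\mathbf{z}^k,\bm{\lambda}^k)\}_{k\geqslant 0}$ be the sequence generated by the PPG-ADMM iteration described in the context from an arbitrary initial point. Then there is a constant $\zeta>0$ (depending on the problem data, on the algorithm parameters $\rho,\beta,\tau_F,\tau_H,d$ and on the initial point,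 but not on $K$ or $\epsilon$) such that for every integer $K\geqslant 1$ there exists an index $j$ with $1\leqslant j\leqslant K$ for which the point $(\mathbf{x}^{j+1},\mathbf{z}^{j+1},\bm{\lambda}^{j+1})$ has the following two properties, for every $\epsilon>0$: (a) if $K=\zeta^2/\epsilon^2$, then $(\mathbf{x}^{j+1},\mathbf{z}^{j+1},\bm{\lambda}^{j+1})$ is an $\epsilon$-AKKT point; (b) if $\beta=1/K$ and $K=(\zeta+\sqrt{2\hat{\mathcal{P}}})^2/\epsilon^2+\rho$, where $\hat{\mathcal{P}}$ is a finite constant bounding the dual sequence in the sense that $\frac{\beta(1-\rho\beta)}{2}\Vert\bm{\lambda}^k\Vert^2\leqslant\hat{\mathcal{P}}$ for all $k\geqslant 0$, then $(\mathbf{x}^{j+1},\mathbf{z}^{j+1},\bm{\lambda}^{j+1})$ is an $\epsilon$-KKT point.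
   Context: **Problem.** $\min_{\mathbf{x}\in\mathbb{R}^n,\mathbf{z}\in\mathbb{R}^m} F(\mathbf{x})+H(\mathbf{z})$ subject to $\mathbf{A}\mathbf{x}+\mathbf{B}\mathbf{z}=\mathbf{c}$, where $\mathbf{A}\in\mathbb{R}^{p\times n}$, $\mathbf{B}\in\mathbb{R}^{p\times m}$, $\mathbf{c}\in\mathbb{R}^p$, $F=F^0+F^1$, $H=H^0+H^1$, with $F^0:\mathbb{R}^n\to\mathbb{R}$, $H^0:\mathbb{R}^m\to\mathbb{R}$, $F^1:\mathbb{R}^n\to\mathbb{R}\cup\{+\infty\}$, $H^1:\mathbb{R}^m\to\mathbb{R}\cup\{+\infty\}$. **Notation.** $\Vert\cdot\Vert$ is the Euclidean (or induced operator) norm; $\Vert \mathbf{y}\Vert_{\mathbf{M}}^2=\langle \mathbf{y},\mathbf{M}\mathbf{y}\rangle$ for symmetric $\mathbf{M}$; $\mathbf{M}\succ\mathbf{N}$ means $\mathbf{M}-\mathbf{N}$ is positive definite; $\mathrm{dist}(\mathbf{y},\mathcal{C})=\inf_{\mathbf{u}\in\mathcal{C}}\Vert\mathbf{y}-\mathbf{u}\Vert$. $\partial g$ is the limiting subdifferential: with the Fréchet subdifferential $\hat\partial g(x)=\{v:\liminf_{y\to x,y\neq x}\frac{g(y)-g(x)-\langle v,y-x\rangle}{\Vert y-x\Vert}\geqslant 0\}$, $v\in\partial g(x)$ iff there are $x^k\to x$ with $g(x^k)\to g(x)$ and $v^k\in\hat\partial g(x^k)$ with $v^k\to v$. A function $g$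 is coercive if $g(x)\to\infty$ as $\Vert x\Vert\to\infty$; $g$ is $\gamma$-weakly convex, $\gamma\geqslant0$, if $g+\frac{\gamma}{2}\Vert\cdot\Vert^2$ is convex. A stationary point of the problem is a point satisfying the KKT conditions, i.e. the $\epsilon$-KKT conditions defined at the end of this context with $\epsilon=0$. The parameter $d$ is an auxiliary positive parameter (it does not enter the iteration). **PPG-ADMM iteration.** Let $\mathbf{P}=\tau_F\mathbf{I}-\rho\mathbf{A}^\top\mathbf{A}$ and $\mathbf{Q}=\tau_H\mathbf{I}-\rho\mathbf{B}^\top\mathbf{B}$. Given arbitrary $\mathbf{x}^0\in\mathbb{R}^n,\mathbf{z}^0\in\mathbb{R}^m,\bm{\lambda}^0\in\mathbb{R}^p$, for $k\geqslant0$: $$\mathbf{x}^{k+1}=\arg\min_{\mathbf{x}}\Big\{\langle\nabla F^0(\mathbf{x}^k),\mathbf{x}\rangle+F^1(\mathbf{x})+\tfrac{\rho}{2}\Vert\mathbf{A}\mathbf{x}+\mathbf{B}\mathbf{z}^k-\mathbf{c}\Vert^2-\langle(1-\rho\beta)\bm{\lambda}^k,\mathbf{A}\mathbf{x}+\mathbf{B}\mathbf{z}^k-\mathbf{c}\rangle+\tfrac12\Vert\mathbf{x}-\mathbf{x}^k\Vert_{\mathbf{P}}^2\Big\},$$ $$\mathbf{z}^{k+1}=\arg\min_{\mathbf{z}}\Big\{\langle\nabla H^0(\mathbf{z}^k),\mathbf{z}\rangle+H^1(\mathbf{z})+\tfrac{\rho}{2}\Vert\mathbf{A}\mathbf{x}^{k+1}+\mathbf{B}\mathbf{z}-\mathbf{c}\Vert^2-\langle(1-\rho\beta)\bm{\lambda}^k,\mathbf{A}\mathbf{x}^{k+1}+\mathbf{B}\mathbf{z}-\mathbf{c}\rangle+\tfrac12\Vert\mathbf{z}-\mathbf{z}^k\Vert_{\mathbf{Q}}^2\Big\},$$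 $$\bm{\lambda}^{k+1}=(1-\rho\beta)\bm{\lambda}^k-\rho(\mathbf{A}\mathbf{x}^{k+1}+\mathbf{B}\mathbf{z}^{k+1}-\mathbf{c}).$$ **$\epsilon$-AKKT and $\epsilon$-KKT points.** For a point $(\mathbf{x}^*,\mathbf{z}^*,\bm{\lambda}^* )$ and $\epsilon\geqslant 0$ consider (i) $\mathrm{dist}(\mathbf{0},\nabla F^0(\mathbf{x}^* )+\partial F^1(\mathbf{x}^* )-\mathbf{A}^\top\bm{\lambda}^* )\leqslant\epsilon$; (ii) $\mathrm{dist}(\mathbf{0},\nabla H^0(\mathbf{z}^* )+\partial H^1(\mathbf{z}^* )-\mathbf{B}^\top\bm{\lambda}^* )\leqslant\epsilon$; (iii) $\Vert\mathbf{A}\mathbf{x}^*+\mathbf{B}\mathbf{z}^*-\mathbf{c}+\beta\bm{\lambda}^*\Vert\leqslant\epsilon$; (iv) $\Vert\mathbf{A}\mathbf{x}^*+\mathbf{B}\mathbf{z}^*-\mathbf{c}\Vert\leqslant\epsilon$. The point is an $\epsilon$-AKKT point if (i), (ii), (iii) hold, and an $\epsilon$-KKT point if (i), (ii), (iv) hold. *)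

(* Defs.v *)
From HB Require Import structures.
From mathcomp Require Import all_boot all_order all_algebra.
From mathcomp Require Import all_classical all_reals all_analysis.
Set Implicit Arguments.
Unset Strict Implicit.
Unset Printing Implicit Defensive.
Import Order.TTheory GRing.Theory Num.Theory.
Import numFieldNormedType.Exports.
Local Open Scope classical_set_scope.
Local Open Scope ring_scope.

Section Euclidean.
Context {R : realType}.

Definition dot n (u v : 'cV[R]_n) : R := \sum_(i < n) u i 0 * v i 0.

(* The library norm `|u| on 'cV[R]_n is the sup norm; it induces the same
   topology, but every inequality below is about the Euclidean norm. *)
Definition enorm n (u : 'cV[R]_n) : R := Num.sqrt (dot u u).

Definition mnorm2 n (M : 'M[R]_n) (y : 'cV[R]_n) : R := dot y (M *m y).

Definition posdef n (M : 'M[R]_n) : Prop :=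
  M^T = M /\ forall u : 'cV[R]_n, u != 0 -> 0 < dot u (M *m u).

Definition mxsucc n (M N : 'M[R]_n) : Prop := posdef (M - N).

(* Extended-real valued, so that the distance to the empty set is +oo. *)
Definition dist n (y : 'cV[R]_n) (C : set 'cV[R]_n) : \bar R :=
  ereal_inf [set (enorm (y - u))%:E | u in C].

Definition grad n (f : 'cV[R]_n -> R) (x : 'cV[R]_n) : 'cV[R]_n :=
  \col_(i < n) 'D_(delta_mx i 0) f x.

Definition lipschitz_gradient n (L : R) (f : 'cV[R]_n -> R) : Prop :=
  (forall x, differentiable f x) /\
  (forall x y, enorm (grad f x - grad f y) <= L * enorm (x - y)).

End Euclidean.

Section Extended_functions.
Context {R : realType}.
Local Open Scope ereal_scope.

Definition proper_efun n (g : 'cV[R]_n -> \bar R) : Prop :=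
  (forall x, g x != -oo) /\ (exists x, g x < +oo).

Definition closed_fun n (g : 'cV[R]_n -> \bar R) : Prop :=
  closed [set p : 'cV[R]_n * R | g p.1 <= p.2%:E].

Definition convex_efun n (g : 'cV[R]_n -> \bar R) : Prop :=
  forall (x y : 'cV[R]_n) (t : R), (0 < t < 1)%R ->
    g (t *: x + (1 - t) *: y)%R <= t%:E * g x + (1 - t)%:E * g y.

Definition weakly_convex n (gamma : R) (g : 'cV[R]_n -> \bar R) : Prop :=
  (0 <= gamma)%R /\
  convex_efun (fun x => g x + (gamma / 2 * enorm x ^+ 2)%:E).

Definition bounded_below n (g : 'cV[R]_n -> \bar R) : Prop :=
  exists b : R, forall x, b%:E <= g x.

Definition coercive n (g : 'cV[R]_n -> \bar R) : Prop :=
  forall b : R, exists r : R, forall x, (r < enorm x)%R -> b%:E < g x.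

(* Both subdifferentials are empty outside the effective domain. *)
Definition frechet_subdiff n (g : 'cV[R]_n -> \bar R) (x : 'cV[R]_n) :
    set 'cV[R]_n :=
  [set v | g x \is a fin_num /\
     0 <= limf_einf (fun y => (g y - g x - (dot v (y - x))%:E)
                              * ((enorm (y - x))^-1)%:E) x^'].

Definition limiting_subdiff n (g : 'cV[R]_n -> \bar R) (x : 'cV[R]_n) :
    set 'cV[R]_n :=
  [set v | g x \is a fin_num /\
     exists (xk vk : nat -> 'cV[R]_n),
       [/\ xk k @[k --> \oo] --> x,
           g (xk k) @[k --> \oo] --> g x,
           (forall k, frechet_subdiff g (xk k) (vk k)) &
           vk k @[k --> \oo] --> v]].

Definition argmin n (g : 'cV[R]_n -> \bar R) : set 'cV[R]_n :=
  [set x | forall y, g x <= g y].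

End Extended_functions.

Section PPG_ADMM.
Context {R : realType} {n m p : nat}.
Variables (A : 'M[R]_(p, n)) (B : 'M[R]_(p, m)) (c : 'cV[R]_p).
Variables (F0 : 'cV[R]_n -> R) (F1 : 'cV[R]_n -> \bar R).
Variables (H0 : 'cV[R]_m -> R) (H1 : 'cV[R]_m -> \bar R).

Definition residual (x : 'cV[R]_n) (z : 'cV[R]_m) : 'cV[R]_p :=
  A *m x + B *m z - c.

Definition feasible : Prop := exists x z, A *m x + B *m z = c.

Definition dual_stationary (eps : R) (x : 'cV[R]_n) (z : 'cV[R]_m)
    (lam : 'cV[R]_p) : Prop :=
  (dist 0 [set (grad F0 x + s - A^T *m lam)%R | s in limiting_subdiff F1 x]
     <= eps%:E)%E /\
  (dist 0 [set (grad H0 z + s - B^T *m lam)%R | s in limiting_subdiff H1 z]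
     <= eps%:E)%E.

Definition eps_AKKT (beta eps : R) (x : 'cV[R]_n) (z : 'cV[R]_m)
    (lam : 'cV[R]_p) : Prop :=
  dual_stationary eps x z lam /\ enorm (residual x z + beta *: lam) <= eps.

Definition eps_KKT (eps : R) (x : 'cV[R]_n) (z : 'cV[R]_m)
    (lam : 'cV[R]_p) : Prop :=
  dual_stationary eps x z lam /\ enorm (residual x z) <= eps.

Definition has_stationary_point : Prop := exists x z lam, eps_KKT 0 x z lam.

Variables (rho beta tauF tauH : R).

Definition Pmx : 'M[R]_n := tauF%:M - rho *: (A^T *m A).
Definition Qmx : 'M[R]_m := tauH%:M - rho *: (B^T *m B).

Definition penalty (lam : 'cV[R]_p) (x : 'cV[R]_n) (z : 'cV[R]_m) : R :=
  rho / 2 * enorm (residual x z) ^+ 2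
  - dot ((1 - rho * beta) *: lam) (residual x z).

Definition x_objective (xk : 'cV[R]_n) (zk : 'cV[R]_m) (lam : 'cV[R]_p)
    (x : 'cV[R]_n) : \bar R :=
  ((dot (grad F0 xk) x)%:E + F1 x + (penalty lam x zk)%:E
   + (2^-1 * mnorm2 Pmx (x - xk))%:E)%E.

Definition z_objective (xk1 : 'cV[R]_n) (zk : 'cV[R]_m) (lam : 'cV[R]_p)
    (z : 'cV[R]_m) : \bar R :=
  ((dot (grad H0 zk) z)%:E + H1 z + (penalty lam xk1 z)%:E
   + (2^-1 * mnorm2 Qmx (z - zk))%:E)%E.

Definition PPG_ADMM (x : nat -> 'cV[R]_n) (z : nat -> 'cV[R]_m)
    (lam : nat -> 'cV[R]_p) : Prop :=
  forall k : nat,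
    [/\ argmin (x_objective (x k) (z k) (lam k)) (x k.+1),
        argmin (z_objective (x k.+1) (z k) (lam k)) (z k.+1) &
        lam k.+1 = (1 - rho * beta) *: lam k
                   - rho *: residual (x k.+1) (z k.+1)].

End PPG_ADMM.

(* Main.v *)
(** Writing [a = 1 - rho * beta], [r = A x + B z - c] and [D] for increments, let
    [V = F + H - a <lam, r> + rho / 2 |r|^2 - a beta / 2 |lam|^2
       + d (a / rho |D lam|^2 + |D x|_P^2 + |D z|_Q^2)
       + d LF |D x|^2 + d LH |D z|^2 + 2 d rho |B D z|^2].
    The two proximal steps decrease the first line up to a multiple of
    [|D lam|^2]; subtracting the optimality conditions of two consecutive
    iterations and using the monotonicity of weakly convex subdifferentials
    shows that the other lines absorb this multiple.  So [V] decreases by a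
    multiple of the squared step [|D x|^2 + |D z|^2 + |D lam|^2].  Moreover
    [V] is at least [inf F + inf H] plus the increment of
    [a^2 / (2 rho) |lam|^2]; as [V] is nonincreasing and these increments
    telescope, [V >= inf F + inf H].  Hence the squared steps are summable and
    the best one among [K] is [O(1/K)], while the step length bounds the
    violation of the approximate KKT conditions. *)

Require Import Defs.
From HB Require Import structures.
From mathcomp Require Import all_boot all_order all_algebra.
From mathcomp Require Import all_classical all_reals all_analysis.
From mathcomp Require Import ring lra.
Set Implicit Arguments.
Unset Strict Implicit.
Unset Printing Implicit Defensive.
Import Order.TTheory GRing.Theory Num.Theory.
Import numFieldNormedType.Exports.
Local Open Scope classical_set_scope.
Local Open Scope ring_scope.

(** * Euclidean inner product and norm estimates *)

Section Euclidean.
Context {R : realType}.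

Lemma dotC n (u v : 'cV[R]_n) : dot u v = dot v u.
Proof. by apply: eq_bigr => i _; rewrite mulrC. Qed.

Lemma dotDl n (u v w : 'cV[R]_n) : dot (u + v) w = dot u w + dot v w.
Proof. by rewrite -big_split; apply: eq_bigr => i _; rewrite mxE mulrDl. Qed.

Lemma dotZl n a (u v : 'cV[R]_n) : dot (a *: u) v = a * dot u v.
Proof. by rewrite mulr_sumr; apply: eq_bigr => i _; rewrite mxE mulrA. Qed.

Lemma dotNl n (u v : 'cV[R]_n) : dot (- u) v = - dot u v.
Proof. by rewrite -scaleN1r dotZl mulN1r. Qed.

Lemma dotDr n (u v w : 'cV[R]_n) : dot u (v + w) = dot u v + dot u w.
Proof. by rewrite dotC dotDl !(dotC u). Qed.

Lemma dotZr n a (u v : 'cV[R]_n) : dot u (a *: v) = a * dot u v.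
Proof. by rewrite dotC dotZl dotC. Qed.

Lemma dotNr n (u v : 'cV[R]_n) : dot u (- v) = - dot u v.
Proof. by rewrite dotC dotNl dotC. Qed.

Lemma dot0l n (u : 'cV[R]_n) : dot 0 u = 0.
Proof. by rewrite -(scale0r 0) dotZl mul0r. Qed.

Lemma dot0r n (u : 'cV[R]_n) : dot u 0 = 0.
Proof. by rewrite dotC dot0l. Qed.

Definition dotE := (dotDl, dotDr, dotNl, dotNr, dotZl, dotZr).

Lemma dot_trmx m n (M : 'M[R]_(m, n)) (u : 'cV[R]_m) (v : 'cV[R]_n) :
  dot (M^T *m u) v = dot u (M *m v).
Proof.
transitivity (\sum_(i < n) \sum_(j < m) M j i * u j 0 * v i 0).
  by apply: eq_bigr => i _; rewrite mxE mulr_suml; under eq_bigr do rewrite mxE.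
rewrite exchange_big; apply: eq_bigr => j _; rewrite mxE mulr_sumr.
by apply: eq_bigr => i _; rewrite mulrCA mulrA.
Qed.

Lemma dot_ge0 n (u : 'cV[R]_n) : 0 <= dot u u.
Proof. by apply: sumr_ge0 => i _; rewrite -expr2 sqr_ge0. Qed.

Lemma enorm_ge0 n (u : 'cV[R]_n) : 0 <= enorm u.
Proof. exact: sqrtr_ge0. Qed.

Lemma enorm_sqr n (u : 'cV[R]_n) : enorm u ^+ 2 = dot u u.
Proof. by rewrite sqr_sqrtr // dot_ge0. Qed.

Lemma enormN n (u : 'cV[R]_n) : enorm (- u) = enorm u.
Proof. by rewrite /enorm dotNl dotNr opprK. Qed.

Lemma enormZ n a (u : 'cV[R]_n) : enorm (a *: u) = `|a| * enorm u.
Proof.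
by rewrite /enorm dotZl dotZr mulrA -expr2 sqrtrM ?sqr_ge0 // sqrtr_sqr.
Qed.

Lemma enorm0 n (u : 'cV[R]_n) : (enorm u == 0) = (u == 0).
Proof.
apply/idP/eqP => [|->]; last by rewrite /enorm dot0l sqrtr0.
rewrite sqrtr_eq0 => u0; have /eqP : dot u u = 0.
  by apply/eqP; rewrite eq_le u0 dot_ge0.
rewrite psumr_eq0 => [/allP ui0|i _]; last by rewrite -expr2 sqr_ge0.
apply/matrixP => i j; rewrite (ord1 j) mxE.
by have := ui0 i (mem_index_enum i); rewrite mulf_eq0 orbb => /eqP.
Qed.

Lemma dot_le_enorm n (u v : 'cV[R]_n) : dot u v <= enorm u * enorm v.
Proof.
have [/eqP|v0] := eqVneq (enorm v) 0.
  by rewrite enorm0 => /eqP ->; rewrite dot0r mulr_ge0 ?enorm_ge0.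
have vp : 0 < enorm v by rewrite lt_def v0 enorm_ge0.
have [/eqP|u0] := eqVneq (enorm u) 0.
  by rewrite enorm0 => /eqP ->; rewrite dot0l mulr_ge0 ?enorm_ge0.
have up : 0 < enorm u by rewrite lt_def u0 enorm_ge0.
have := dot_ge0 (enorm v *: u - enorm u *: v).
rewrite !dotE (dotC v u) -!enorm_sqr.
have := mulr_gt0 up vp; set a := enorm u; set b := enorm v => ab H.
rewrite -subr_ge0 -(pmulr_rge0 _ ab); lra.
Qed.

Lemma enorm_le_add n (u v : 'cV[R]_n) : enorm (u + v) <= enorm u + enorm v.
Proof.
rewrite -(ler_pXn2r (ltn0Sn 1)) ?nnegrE ?addr_ge0 ?enorm_ge0 //.
rewrite enorm_sqr !dotE (dotC v u) sqrrD !enorm_sqr.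
by have := dot_le_enorm u v; lra.
Qed.

Lemma dot_le_young n L (u v w : 'cV[R]_n) : 0 <= L ->
  enorm u <= L * enorm v -> dot u w <= L / 2 * (dot v v + dot w w).
Proof.
move=> L0 uv; apply: le_trans (dot_le_enorm _ _) _.
apply: le_trans (ler_wpM2r (enorm_ge0 w) uv) _; rewrite -!enorm_sqr.
have := mulr_ge0 L0 (sqr_ge0 (enorm v - enorm w)); lra.
Qed.

Lemma dot_le_half n (u w : 'cV[R]_n) : dot u w <= (dot u u + dot w w) / 2.
Proof.
by have := @dot_le_young n 1 u u w ler01; rewrite mul1r lexx => /(_ isT); lra.
Qed.

(** The constant is the sum of the row norms: Cauchy-Schwarz bounds each coordinate of the image,
    and the Euclidean norm is at most the sum of the absolute coordinates. *)
Lemma enorm_mulmx_le m n (M : 'M[R]_(m, n)) :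
  exists2 C : R, 0 <= C & forall u, enorm (M *m u) <= C * enorm u.
Proof.
exists (\sum_i enorm (row i M)^T) => [|u]; first by apply: sumr_ge0 => i _; exact: enorm_ge0.
suff sumE (w : 'cV[R]_m) : enorm w <= \sum_i `|w i 0|.
  apply: le_trans (sumE _) _; rewrite mulr_suml; apply: ler_sum => i _.
  have -> : (M *m u) i 0 = dot (row i M)^T u.
    by rewrite mxE; apply: eq_bigr => j _; rewrite !mxE.
  rewrite ler_norml dot_le_enorm andbT lerNl -dotNl.
  by apply: le_trans (dot_le_enorm _ _) _; rewrite enormN.
have s0 : 0 <= \sum_i `|w i 0| by apply: sumr_ge0.
rewrite -(ler_pXn2r (ltn0Sn 1)) ?nnegrE ?enorm_ge0 // enorm_sqr expr2 mulr_suml.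
apply: ler_sum => i _; rewrite -expr2 -real_normK ?num_real // expr2 ler_wpM2l //.
by rewrite (bigD1 i) //= lerDl sumr_ge0.
Qed.

Lemma enorm_le_norm n : exists2 C : R, 0 <= C & forall u : 'cV[R]_n, enorm u <= C * `|u|.
Proof.
exists n%:R => // u.
have un (i : 'I_n) : `|u i 0| <= `|u|.
  by rewrite [`|u|]mx_normrE; exact: (le_bigmax _ (fun ij => `|u ij.1 ij.2|) (i, 0)).
rewrite -(ler_pXn2r (ltn0Sn 1)) ?nnegrE ?enorm_ge0 ?mulr_ge0 // enorm_sqr.
apply: (@le_trans _ _ (\sum_(i < n) `|u| ^+ 2)).
  by apply: ler_sum => i _; rewrite -expr2 -real_normK ?num_real // ler_pXn2r ?nnegrE.
rewrite sumr_const card_ord -[X in X <= _]mulr_natl exprMn ler_wpM2r ?sqr_ge0 //.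
by rewrite -natrX ler_nat; case: n {u un} => // n; rewrite -mulnn leq_pmull.
Qed.

Lemma posdef_ge0 n (M : 'M[R]_n) u : posdef M -> 0 <= dot u (M *m u).
Proof.
case=> _ M0; have [->|/M0/ltW//] := eqVneq u 0.
by rewrite dot0l.
Qed.

Lemma dot_symC n (M : 'M[R]_n) u v : M^T = M -> dot u (M *m v) = dot v (M *m u).
Proof. by move=> Ms; rewrite -dot_trmx Ms dotC. Qed.

End Euclidean.

(** * Gradients and the descent inequality *)

Section Gradient.
Context {R : realType}.

Lemma derive_grad n (f : 'cV[R]_n -> R) x h :
  differentiable f x -> 'D_h f x = dot (grad f x) h.
Proof.
move=> df; rewrite deriveE // [in LHS](matrix_sum_delta h) linear_sum.
apply: eq_bigr => i _; rewrite big_ord1 linearZ /= mxE mulrC deriveE //.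
Qed.

(* The mean value theorem gives [L] instead of the optimal [L / 2]; the
   parameter conditions leave room for the loss. *)
Lemma lipschitz_gradient_descent n (L : R) (f : 'cV[R]_n -> R) x y :
  0 <= L -> lipschitz_gradient L f ->
  f y <= f x + dot (grad f x) (y - x) + L * dot (y - x) (y - x).
Proof.
move=> L0 [df lf]; set h := y - x; set g := fun t : R => f (t *: h + x).
have gE (t : R) : (fun s : R => s^-1 *: ((g \o shift t) (s *: (1:R)) - g t)) =
    (fun s : R => s^-1 *: ((f \o shift (t *: h + x)) (s *: h) - f (t *: h + x))).
  by apply/funext => s; rewrite /g /= [s *: 1]mulr1 scalerDl addrA.
have gd (t : R) : is_derive t 1 g (dot (grad f (t *: h + x)) h).
  apply: DeriveDef; last by rewrite -derive_grad // /derive gE.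
  by rewrite /derivable gE; exact/diff_derivable.
have [t t01 gt] : exists2 t, t \in `[0, 1]%R &
    g 1 - g 0 = dot (grad f (t *: h + x)) h * (1 - 0).
  apply: (@MVT_segment _ g (fun t => dot (grad f (t *: h + x)) h)) => //.
  by apply: derivable_within_continuous => t _; case: (gd t).
move: gt; rewrite /g scale1r scale0r add0r subr0 mulr1 /h subrK -/h => gt.
suff : dot (grad f (t *: h + x) - grad f x) h <= L * dot h h by rewrite dotDl dotNl; lra.
apply: le_trans (dot_le_enorm _ _) _.
rewrite -enorm_sqr expr2 mulrA ler_wpM2r ?enorm_ge0 //.
apply: le_trans (lf _ _) _; rewrite addrK enormZ ler_wpM2l //.
move: t01; rewrite in_itv /= => /andP[t0 t1].
by rewrite ger0_norm // ler_piMl ?enorm_ge0.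
Qed.

End Gradient.

(** * Subgradients of weakly convex functions *)

Section Weak_subgradient.
Context {R : realType}.

(* Over a weakly convex function this global inequality characterises the
   limiting subgradients. *)
Definition weak_subgradient n (gamma : R) (g : 'cV[R]_n -> \bar R)
    (x s : 'cV[R]_n) : Prop :=
  g x \is a fin_num /\ forall y,
  ((fine (g x) + dot s (y - x) - gamma / 2 * dot (y - x) (y - x))%:E <= g y)%E.

(** The difference quotient at [y] is at least [- gamma / 2 * enorm (y - x)], which tends to 0; the
    sup-norm comparison turns this into a neighbourhood of [x]. *)
Lemma weak_subgradient_frechet n gamma (g : 'cV[R]_n -> \bar R) x s :
  0 <= gamma -> weak_subgradient gamma g x s -> frechet_subdiff g x s.
Proof.
move=> g0 [gx gs]; split=> //; apply/lee_subgt0Pr => e e0; rewrite add0e.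
have [C C0 hC] := @enorm_le_norm R n.
rewrite limf_einfE; apply: le_trans (ereal_sup_ubound _); last first.
  exists [set y | y != x /\ gamma / 2 * enorm (y - x) <= e] => //.
  have c0 : 0 < gamma / 2 * C + 1 by rewrite ltr_wpDl ?mulr_ge0 ?divr_ge0.
  have : \forall y \near x, `|y - x| < e / (gamma / 2 * C + 1).
    by near=> y; rewrite distrC; near: y; apply: cvgr_dist_lt => //; exact: divr_gt0.
  rewrite /dnbhs /within /=; apply: filterS => y; rewrite ltr_pdivlMr // => yx yx0.
  split=> //; apply: le_trans (ltW yx).
  apply: le_trans (ler_wpM2l _ (hC _)) _; first exact: divr_ge0.
  by rewrite mulrA mulrC ler_wpM2l // lerDl.
apply: le_ereal_inf_tmp => _ [y [yx ye] <-].
have d0 : 0 < enorm (y - x) by rewrite lt_def enorm_ge0 enorm0 subr_eq0 yx.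
have := gs y; rewrite -(fineK gx) /=; case: (g y) => [r| |] //; last first.
  by move=> _; rewrite mulyr gtr0_sg ?invr_gt0 // mul1e leey.
rewrite -!EFinB -EFinM !lee_fin => gr.
rewrite ler_pdivlMr // mulNr.
have := ler_wpM2r (ltW d0) ye; rewrite -enorm_sqr in gr; lra.
Unshelve. all: by end_near.
Qed.

Lemma weak_subgradient_limiting n gamma (g : 'cV[R]_n -> \bar R) x s :
  0 <= gamma -> weak_subgradient gamma g x s -> limiting_subdiff g x s.
Proof.
move=> g0 gs; have [gx _] := gs; split=> //.
exists (fun=> x), (fun=> s); split; try exact: cvg_cst.
by move=> k; apply: weak_subgradient_frechet gs.
Qed.

(** Each subgradient inequality is tested at the base point of the other; in the sum the values of
    [g] cancel. *)
Lemma weak_subgradient_monotone n gamma (g : 'cV[R]_n -> \bar R) x y s t :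
  weak_subgradient gamma g x s -> weak_subgradient gamma g y t ->
  - gamma * dot (y - x) (y - x) <= dot (t - s) (y - x).
Proof.
move=> [gx /(_ y)] + [gy /(_ x)].
rewrite -(fineK gx) -(fineK gy) !lee_fin /= -(opprB y x); move: (y - x) => h.
by rewrite !dotE; lra.
Qed.

End Weak_subgradient.

(** * Optimality conditions of the proximal steps *)

Section Proximal_step.
Context {R : realType}.

Lemma ler_fine_add n (f : 'cV[R]_n -> R) (g : 'cV[R]_n -> \bar R) b y :
  (b%:E <= (f y)%:E + g y)%E -> g y \is a fin_num -> b <= f y + fine (g y).
Proof. by move=> + gy; rewrite -{1}(fineK gy) -EFinD lee_fin. Qed.

Lemma ler_vanishing_slope (a b s : R) :
  (forall t, 0 < t < 1 -> a <= b + t * s) -> a <= b.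
Proof.
move=> H; rewrite leNgt; apply/negP; rewrite -subr_gt0; set e := a - b => e0.
have s0 := normr_ge0 s.
have D0 : 0 < e + `|s| + 1 by lra.
have t0 : 0 < e / (e + `|s| + 1) by exact: divr_gt0.
(* This [t] lies in the unit interval and makes [t * s] smaller than the gap [e]. *)
have := H (e / (e + `|s| + 1)).
rewrite t0 ltr_pdivrMr // => /(_ ltac:(lra)).
apply/negP; rewrite -ltNge addrC -ltrBrDr -/e mulrAC ltr_pdivrMr //.
have := ler_norm s; nra.
Qed.

(** The minimiser is compared with [x + t *: h] on the segment towards [y]; weak convexity bounds
    [g] there, and dividing by [t] and letting [t] tend to 0 leaves the subgradient inequality. *)
Lemma argmin_weak_subgradient n gamma tau (g : 'cV[R]_n -> \bar R)
    (q : 'cV[R]_n -> R) x v :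
  proper_efun g -> weakly_convex gamma g ->
  (forall h, q (x + h) = q x + dot v h + tau / 2 * dot h h) ->
  argmin (fun y => g y + (q y)%:E)%E x -> weak_subgradient gamma g x (- v).
Proof.
move=> [gNy [x0 gx0]] [gamma0 gcvx] qE xmin.
have gx : g x \is a fin_num.
  rewrite fin_numE gNy /=; apply: contraTneq (xmin x0) => gxy.
  rewrite -ltNge gxy addye // ltey_eq fin_numD /= andbT.
  by rewrite fin_numE gNy lt_eqF.
split=> // y; have gyNy := gNy y.
have /= := gcvx y x; case gyE : (g y) gyNy => [b| |] // _ cvx; last by rewrite leey.
move: gx xmin cvx; case gxE : (g x) => [a| |] // _ xmin cvx.
(* After division by [t], the terms still carrying a factor [t] are [tau / 2] from [q] and
   [- gamma / 2] from the weak convexity defect [gamma / 2 * t * (1 - t) * dot h h]. *)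
rewrite lee_fin /=; move: (y - x) (subrK x y) => h hE.
apply: (@ler_vanishing_slope _ _ ((tau - gamma) / 2 * dot h h)) => t t01.
have := cvx t t01; have := xmin (x + t *: h); rewrite gxE /= qE.
have -> : t *: y + (1 - t) *: x = x + t *: h.
  by rewrite -hE scalerDr scalerBl scale1r; rewrite -addrA [t *: x + _]addrC subrK addrC.
rewrite -hE; case: (g (x + t *: h)) (gNy (x + t *: h)) => [e| |] // _.
rewrite -!EFinD !lee_fin !enorm_sqr !dotE (dotC h x).
move: t01 => /andP[t0 t1] H1 H2.
rewrite -(ler_pM2l t0); lra.
Qed.

Lemma dot_Pmx n p (M : 'M[R]_(p, n)) rho tau u v :
  dot u (Pmx M rho tau *m v) = tau * dot u v - rho * dot (M *m u) (M *m v).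
Proof.
rewrite mulmxBl mul_scalar_mx -scalemxAl -mulmxA dotDr dotNr !dotZr.
by rewrite (dotC u (M^T *m _)) dot_trmx (dotC (M *m v)).
Qed.

Lemma mxsucc_dot_ge0 n p (M : 'M[R]_(p, n)) tau a b u :
  mxsucc tau%:M (a *: (M^T *m M) + b%:M) ->
  a * dot (M *m u) (M *m u) + b * dot u u <= tau * dot u u.
Proof.
move=> /(posdef_ge0 u).
rewrite mulmxBl mulmxDl !mul_scalar_mx -scalemxAl -mulmxA !dotE.
by rewrite (dotC u (M^T *m _)) dot_trmx; lra.
Qed.

(** The matrix [Pmx M rho tau] cancels the Hessian [rho *: (M^T *m M)] of the penalty, so the smooth
    part is a quadratic with Hessian [tau%:M]. *)
Lemma prox_weak_subgradient n p gamma (M : 'M[R]_(p, n)) rho tau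
    (g : 'cV[R]_n -> \bar R) (w y0 x : 'cV[R]_n) (e mu : 'cV[R]_p) :
  proper_efun g -> weakly_convex gamma g ->
  argmin (fun y => (dot w y)%:E + g y
    + (rho / 2 * enorm (M *m y + e) ^+ 2 - dot mu (M *m y + e))%:E
    + (2^-1 * mnorm2 (Pmx M rho tau) (y - y0))%:E)%E x ->
  weak_subgradient gamma g x
    (- (w + M^T *m (rho *: (M *m x + e) - mu) + Pmx M rho tau *m (x - y0))).
Proof.
move=> gp gw xmin; pose q y := dot w y +
  (rho / 2 * enorm (M *m y + e) ^+ 2 - dot mu (M *m y + e)) +
  2^-1 * mnorm2 (Pmx M rho tau) (y - y0).
apply: (@argmin_weak_subgradient _ _ tau g q) => // [h|y]; last first.
  have := xmin y; rewrite /q.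
  by rewrite ![((dot w _)%:E + g _)%E]addeC -!addeA -!EFinD !addrA.
rewrite /q mulmxDr; move: (M *m x + e) (addrAC (M *m x) (M *m h) e) => r ->.
rewrite -(addrAC x); move: (x - y0) => d.
rewrite !enorm_sqr /mnorm2 !dotDl dot_trmx [dot (_ *m d) h]dotC !dot_Pmx.
rewrite !mulmxDr !dotE (dotC (M *m d)) (dotC d) (dotC (M *m h) r).
by field.
Qed.

End Proximal_step.

(** * Algebraic identities for the dual update *)

Section Dual_step.
Context {R : realType} {p : nat}.
Variables (rho beta : R) (rho0 : rho != 0).
Let alpha := 1 - rho * beta.
Implicit Types lam r a b : 'cV[R]_p.

(** Here [a] and [b] are the increments of [A x] and [B z]. The first two terms come from the block
    descents: the x-step carries the multiplier [lam' + rho *: b] because it sees the old [z]. The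
    others are the change of the penalty and dual terms of the potential. *)
Lemma perturbed_lagrangian_step lam lam' r r' a b :
  r' = r + a + b -> lam' = alpha *: lam - rho *: r' ->
  dot lam' (a + b) + rho * dot b a - alpha * dot lam' r' + alpha * dot lam r
    + rho / 2 * (dot r' r' - dot r r)
    - alpha * beta / 2 * (dot lam' lam' - dot lam lam)
  = - rho / 2 * (dot a a + dot b b)
    + (alpha / rho - alpha * beta / 2) * dot (lam' - lam) (lam' - lam).
Proof.
move=> -> ->; rewrite /alpha !dotE (dotC a lam) (dotC b lam) (dotC r lam).
by rewrite (dotC a r) (dotC b r) (dotC b a); field.
Qed.

(** Subtracting two dual updates expresses [s] by the two dual increments, and polarisation makes
    their product telescope. The term with [- beta] is the source of the decrease in the dual
    variable. *)
Lemma dual_increment_step lam0 lam lam' r r' s :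
  r' = r + s -> lam = alpha *: lam0 - rho *: r ->
  lam' = alpha *: lam - rho *: r' ->
  dot (lam' - lam) s = - beta * dot (lam' - lam) (lam' - lam)
    - alpha / (2 * rho) * (dot (lam' - lam) (lam' - lam)
                           - dot (lam - lam0) (lam - lam0)
        + dot (lam' - lam - (lam - lam0)) (lam' - lam - (lam - lam0))).
Proof.
move=> -> -> ->; rewrite /alpha !dotE.
by rewrite (dotC s lam0) (dotC r lam0) (dotC s r); field.
Qed.

Lemma dual_residual_telescope lam0 lam r :
  lam = alpha *: lam0 - rho *: r ->
  - alpha * dot lam r = alpha * beta * dot lam lam
    + alpha ^+ 2 / (2 * rho) * (dot lam lam - dot lam0 lam0
                                + dot (lam - lam0) (lam - lam0)).
Proof.
move=> ->; by rewrite /alpha !dotE (dotC r lam0); field.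
Qed.

End Dual_step.

(** * Descent along real sequences *)

Section Real_sequences.
Context {R : realType}.

(** If [V k < b], then from [k] on each step lowers [u] by at least [b - V k], which contradicts
    [0 <= u] after finitely many steps. *)
Lemma nonincreasing_telescope_ge (V u : nat -> R) (b : R) :
  (forall k, V k.+1 <= V k) -> (forall k, 0 <= u k) ->
  (forall k, b + u k.+1 - u k <= V k) -> forall k, b <= V k.
Proof.
move=> Vdec u0 Vb k; rewrite leNgt; apply/negP => Vk.
have Vle i : V (k + i)%N <= V k.
  by elim: i => [|i IH]; rewrite ?addn0 // addnS; apply: le_trans IH.
have sum N : N%:R * (b - V k) + u (k + N)%N <= u k.
  elim: N => [|N IH]; first by rewrite mul0r add0r addn0.
  by rewrite addnS -natr1; have := Vb (k + N)%N; have := Vle N; lra.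
have e0 : 0 < b - V k by rewrite subr_gt0.
have := sum (Num.truncn (u k / (b - V k))).+1; apply/negP; rewrite -ltNge.
have := truncnS_gt (u k / (b - V k)); rewrite ltr_pdivrMr // => uk.
exact: lt_le_trans uk (ler_wpDr _ _).
Qed.

(** Otherwise the decreases at the indices 1 to [K] would sum to at least [V 0%N - b + c]; the added
    1 in the bound provides the contradictory surplus [c]. *)
Lemma descent_small_step (V D : nat -> R) (b c : R) K :
  0 < c -> (forall k, V k.+1 + c * D k.+1 <= V k) -> (forall k, b <= V k) ->
  (1 <= K)%N -> exists2 j, (1 <= j <= K)%N & K%:R * D j <= (V 0%N - b) / c + 1.
Proof.
move=> c0 Vdec Vb K0; apply: contrapT => /forall2NP H.
have sum N : (N <= K)%N -> V N + c * (N%:R * (((V 0%N - b) / c + 1) / K%:R)) <= V 0%N.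
  elim: N => [|N IH] NK; first by rewrite mul0r mulr0 addr0.
  have := IH (ltnW NK); have := Vdec N.
  case: (H N.+1) => [|/negP]; first by rewrite NK.
  rewrite -ltNge -ltr_pdivrMl ?ltr0n // mulrC => HD.
  have := ltW HD; rewrite -(ler_pM2l c0) -natr1; lra.
have := sum K (leqnn _); have := Vb K.
have K1 : K%:R != 0 :> R by rewrite pnatr_eq0 -lt0n.
have -> : c * (K%:R * (((V 0%N - b) / c + 1) / K%:R)) = V 0%N - b + c.
  by field; rewrite K1 gt_eqF.
lra.
Qed.

End Real_sequences.

(** * Estimates for one block, applied to both [x] and [z] *)

Section Block_estimates.
Context {R : realType} {n p : nat}.
Variables (M : 'M[R]_(p, n)) (P : 'M[R]_n).
Variables (gamma L : R) (f : 'cV[R]_n -> R) (g : 'cV[R]_n -> \bar R).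
Hypotheses (L0 : 0 <= L) (f_lip : lipschitz_gradient L f).

(** The subgradient of [g] at [x'] given by the optimality condition of a linearised proximal step
    from [x], with [mu] the effective multiplier. *)
Definition block_multiplier (x x' : 'cV[R]_n) (mu : 'cV[R]_p) : 'cV[R]_n :=
  - grad f x + M^T *m mu - P *m (x' - x).

(** Adds the descent inequality for [f] to the subgradient inequality at [x'] tested at [x]; the
    gradient terms cancel. *)
Lemma block_descent x x' mu : g x \is a fin_num ->
  weak_subgradient gamma g x' (block_multiplier x x' mu) ->
  f x' + fine (g x') <= f x + fine (g x) + dot mu (M *m (x' - x))
    - dot (x' - x) (P *m (x' - x)) + (gamma / 2 + L) * dot (x' - x) (x' - x).
Proof.
move=> gx [gx' /(_ x)]; rewrite -(fineK gx) lee_fin /=.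
have := lipschitz_gradient_descent x x' L0 f_lip.
rewrite /block_multiplier -(opprB x' x); move: (x' - x) => h.
by rewrite !dotE dot_trmx (dotC (P *m h)); lra.
Qed.

(** Monotonicity applied to the subgradients of two consecutive steps: the [P] term telescopes by
    polarisation, and the gradient increment is bounded by Young's inequality. *)
Lemma block_monotone x0 x1 x2 mu1 mu2 : P^T = P ->
  weak_subgradient gamma g x1 (block_multiplier x0 x1 mu1) ->
  weak_subgradient gamma g x2 (block_multiplier x1 x2 mu2) ->
  - dot (mu2 - mu1) (M *m (x2 - x1))
  + (dot (x2 - x1) (P *m (x2 - x1)) - dot (x1 - x0) (P *m (x1 - x0))
     + dot (x2 - x1 - (x1 - x0)) (P *m (x2 - x1 - (x1 - x0)))) / 2
  <= gamma * dot (x2 - x1) (x2 - x1)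
     + L / 2 * (dot (x1 - x0) (x1 - x0) + dot (x2 - x1) (x2 - x1)).
Proof.
move=> Psym s1 s2; have := weak_subgradient_monotone s1 s2.
have := @dot_le_young _ _ _ _ _ (- (x2 - x1)) L0 (f_lip.2 x1 x0).
rewrite /block_multiplier; move: (x2 - x1) (x1 - x0) => h k.
rewrite mulmxBr !dotE !dot_trmx (dotC (P *m h) h) (dotC (P *m k) h) (dot_symC k h Psym).
by lra.
Qed.

End Block_estimates.

(** The block multiplier is the element of the subdifferential that witnesses the distance; what
    remains is the gradient increment, the proximal term and the multiplier mismatch. *)
Lemma block_dist_le (R : realType) n p (M : 'M[R]_(p, n)) P gamma L
    (f : 'cV[R]_n -> R) (g : 'cV[R]_n -> \bar R) y y' mu l e :
  weakly_convex gamma g -> lipschitz_gradient L f ->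
  weak_subgradient gamma g y' (block_multiplier M P f y y' mu) ->
  L * enorm (y' - y) + enorm (P *m (y' - y)) + enorm (M^T *m (mu - l)) <= e ->
  (dist 0 [set (grad f y' + s - M^T *m l)%R | s in limiting_subdiff g y'] <= e%:E)%E.
Proof.
move=> [gamma0 _] [_ f_lip] sub le_e; apply: ge_ereal_inf.
exists (enorm (0 - (grad f y' + block_multiplier M P f y y' mu - M^T *m l)))%:E.
  exists (grad f y' + block_multiplier M P f y y' mu - M^T *m l) => //.
  by exists (block_multiplier M P f y y' mu) => //; exact: weak_subgradient_limiting sub.
rewrite lee_fin; apply: le_trans le_e; rewrite sub0r enormN.
have -> : grad f y' + block_multiplier M P f y y' mu - M^T *m l =
    (grad f y' - grad f y) - P *m (y' - y) + M^T *m (mu - l).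
  rewrite /block_multiplier [M^T *m (mu - l)]mulmxBr.
  move: (grad f y) (grad f y') (M^T *m _) (M^T *m _) (P *m _) => a1 a2 a3 a4 a5.
  by apply/matrixP => i j; rewrite !mxE; ring.
apply: le_trans (enorm_le_add _ _) _; apply: lerD => //.
by apply: le_trans (enorm_le_add _ _) _; rewrite enormN; apply: lerD.
Qed.

(** * Potential decrease and stationarity along the iterates *)

Section Iterates.
Context {R : realType} {n m p : nat}.
Variables (A : 'M[R]_(p, n)) (B : 'M[R]_(p, m)) (c : 'cV[R]_p).
Variables (F0 : 'cV[R]_n -> R) (F1 : 'cV[R]_n -> \bar R).
Variables (H0 : 'cV[R]_m -> R) (H1 : 'cV[R]_m -> \bar R).
Variables (LF LH gammaF gammaH rho beta tauF tauH d : R).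
Hypotheses (F_bnd : bounded_below (fun x => (F0 x)%:E + F1 x)%E).
Hypotheses (H_bnd : bounded_below (fun z => (H0 z)%:E + H1 z)%E).
Hypotheses (LF_gt0 : 0 < LF) (LH_gt0 : 0 < LH).
Hypotheses (F0_lip : lipschitz_gradient LF F0) (H0_lip : lipschitz_gradient LH H0).
Hypotheses (F1_proper : proper_efun F1) (H1_proper : proper_efun H1).
Hypotheses (F1_wcvx : weakly_convex gammaF F1) (H1_wcvx : weakly_convex gammaH H1).
Hypotheses (rho_gt0 : 0 < rho) (beta_gt0 : 0 < beta) (rhobeta_lt1 : rho * beta < 1).
Hypotheses (d_gt0 : 0 < d)
  (d_gt : (1 - rho * beta) * (2 - rho * beta) < d * (4 * rho * beta)).
Hypotheses (tauF_gt : mxsucc tauF%:M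
     ((2 * d * rho) *: (A^T *m A) + ((4 * d + 3) * LF + (4 * d + 1) * gammaF)%:M)).
Hypotheses (tauH_gt : mxsucc tauH%:M
     ((8 * d * rho) *: (B^T *m B) + ((4 * d + 3) * LH + (4 * d + 1) * gammaH)%:M)).
Hypotheses (P_posdef : posdef (Pmx A rho tauF)) (Q_posdef : posdef (Pmx B rho tauH)).
Variables (x : nat -> 'cV[R]_n) (z : nat -> 'cV[R]_m) (lam : nat -> 'cV[R]_p).
Hypothesis iterates : PPG_ADMM A B c F0 F1 H0 H1 rho beta tauF tauH x z lam.

Let alpha := 1 - rho * beta.
Let P := Pmx A rho tauF.
Let Q := Pmx B rho tauH.
Let r k := residual A B c (x k) (z k).
Let dx k := x k.+1 - x k.
Let dz k := z k.+1 - z k.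
Let dlam k := lam k.+1 - lam k.
(** The x-step uses the old [z], so its effective multiplier exceeds [lam k.+1] by
    [rho *: (B *m dz k)]. *)
Let sx k := block_multiplier A P F0 (x k) (x k.+1) (lam k.+1 + rho *: (B *m dz k)).
Let sz k := block_multiplier B Q H0 (z k) (z k.+1) (lam k.+1).

Lemma lam_step k : lam k.+1 = alpha *: lam k - rho *: r k.+1.
Proof. by case: (iterates k). Qed.

Lemma residual_step k : r k.+1 = r k + A *m dx k + B *m dz k.
Proof.
rewrite /r /residual /dx /dz !mulmxBr.
move: (A *m _) (A *m _) (B *m _) (B *m _) => a a' b b'.
by apply/matrixP => i j; rewrite !mxE; ring.
Qed.

Lemma x_subgradient k : weak_subgradient gammaF F1 (x k.+1) (sx k).
Proof.
have -> : sx k = - (grad F0 (x k) + A^T *m (rho *: (A *m x k.+1 + (B *m z k - c))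
    - alpha *: lam k) + P *m (x k.+1 - x k)).
  rewrite /sx /block_multiplier lam_step !opprD -(mulmxN A^T).
  congr (- _ + _ *m _ - _); rewrite /r /residual /dz mulmxBr.
  move: (A *m _) (B *m _) (B *m _) => a b b'.
  by apply/matrixP => i j; rewrite !mxE; ring.
apply: prox_weak_subgradient => // y; have [/(_ y) + _ _] := iterates k.
by rewrite /x_objective /penalty /residual -!(addrA (A *m _)).
Qed.

Lemma z_subgradient k : weak_subgradient gammaH H1 (z k.+1) (sz k).
Proof.
have -> : sz k = - (grad H0 (z k) + B^T *m (rho *: (B *m z k.+1 + (A *m x k.+1 - c))
    - alpha *: lam k) + Q *m (z k.+1 - z k)).
  rewrite /sz /block_multiplier lam_step !opprD -(mulmxN B^T).
  congr (- _ + _ *m _ - _); rewrite /r /residual.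
  move: (A *m _) (B *m _) => a b.
  by apply/matrixP => i j; rewrite !mxE; ring.
apply: prox_weak_subgradient => // y; have [_ /(_ y) + _] := iterates k.
by rewrite /z_objective /penalty /residual !(addrC (A *m _) (B *m _)) -!(addrA (B *m _)).
Qed.

(* The value after iteration [k.+1]: increments such as [dx k] lead from index
   [k] to [k.+1]; [F1] need not be finite at the arbitrary initial point. *)
Definition potential k : R :=
  F0 (x k.+1) + fine (F1 (x k.+1)) + (H0 (z k.+1) + fine (H1 (z k.+1)))
  - alpha * dot (lam k.+1) (r k.+1) + rho / 2 * dot (r k.+1) (r k.+1)
  - alpha * beta / 2 * dot (lam k.+1) (lam k.+1)
  + d * (alpha / rho * dot (dlam k) (dlam k) + dot (dx k) (P *m dx k)
         + dot (dz k) (Q *m dz k))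
  + d * LF * dot (dx k) (dx k) + d * LH * dot (dz k) (dz k)
  + 2 * d * rho * dot (B *m dz k) (B *m dz k).

Definition step_sqr k : R :=
  dot (dx k) (dx k) + dot (dz k) (dz k) + dot (dlam k) (dlam k).

Lemma alpha_gt0 : 0 < alpha.
Proof. by rewrite subr_gt0. Qed.

Lemma potential_step k :
  potential k.+1 + LF / 2 * dot (dx k.+1) (dx k.+1)
  + LH / 2 * dot (dz k.+1) (dz k.+1)
  + (2 * d * beta - (alpha / rho - alpha * beta / 2)) * dot (dlam k.+1) (dlam k.+1)
  <= potential k.
Proof.
have a0 := alpha_gt0; have rho0 : rho != 0 by rewrite gt_eqF.
have Psym := P_posdef.1; have Qsym := Q_posdef.1.
have [LF0 LH0] := (ltW LF_gt0, ltW LH_gt0).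
have Fd := block_descent LF0 F0_lip (x_subgradient k).1 (x_subgradient k.+1).
have Hd := block_descent LH0 H0_lip (z_subgradient k).1 (z_subgradient k.+1).
have Fm := block_monotone LF0 F0_lip Psym (x_subgradient k) (x_subgradient k.+1).
have Hm := block_monotone LH0 H0_lip Qsym (z_subgradient k) (z_subgradient k.+1).
have I1 := perturbed_lagrangian_step rho0 (residual_step k.+1) (lam_step k.+1).
have I2 := dual_increment_step rho0 (etrans (residual_step k.+1) (esym (addrA _ _ _)))
  (lam_step k) (lam_step k.+1).
(* These conditions are used halved: the [tauF / 2] surplus of the descent covers [d * rho] times
   the square of [A *m dx k.+1], the curvature and gradient errors, and the retained decrease
   [LF / 2]. For [z] the matrix weight is [4 * d * rho]. *)
have tF := mxsucc_dot_ge0 (dx k.+1) tauF_gt.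
have tH := mxsucc_dot_ge0 (dz k.+1) tauH_gt.
have P1 := posdef_ge0 (dx k.+1) P_posdef.
have Q1 := posdef_ge0 (dz k.+1) Q_posdef.
have EP := dot_Pmx A rho tauF (dx k.+1) (dx k.+1).
have EQ := dot_Pmx B rho tauH (dz k.+1) (dz k.+1).
have P2 := mulr_ge0 (ltW d_gt0) (posdef_ge0 (dx k.+1 - dx k) P_posdef).
have Q2 := mulr_ge0 (ltW d_gt0) (posdef_ge0 (dz k.+1 - dz k) Q_posdef).
have w0 : 0 <= d * (alpha / rho) by rewrite mulr_ge0 ?divr_ge0 // ltW.
have l2 := mulr_ge0 w0 (dot_ge0 (dlam k.+1 - dlam k)).
have drho : 0 <= d * rho by rewrite mulr_ge0 // ltW.
(* [Y1] splits the product of [A *m dx k.+1] with the extra multiplier change, and [Y2] separates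
   the old and new [B *m dz]; the last term of the potential pays for the old one. *)
have Y1 := ler_wpM2l drho (dot_le_half (B *m dz k.+1 - B *m dz k) (A *m dx k.+1)).
have Y2 := mulr_ge0 drho (dot_ge0 (B *m dz k.+1 + B *m dz k)).
have d2 : 0 <= 2 * d by rewrite mulr_ge0 // ltW.
(* The weight [2 * d] matches the telescoping terms of [block_monotone] and [dual_increment_step]
   with the weight [d] in the potential. *)
move: (ler_wpM2l d2 Fm) (ler_wpM2l d2 Hm) (congr1 ( *%R (2 * d)) I2) => {}Fm {}Hm {}I2.
have invE : alpha / (2 * rho) = alpha / rho / 2 by field.
move: Fd Hd Fm Hm I1 I2 tF tH P1 Q1 EP EQ P2 Q2 l2 Y1 Y2.
rewrite /potential -/alpha invE /dx /dz /dlam -/P -/Q.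
rewrite (opprD (lam _)) addrACA -scalerBr.
move: (alpha / rho) (lam k.+2 - lam k.+1) (lam k.+1 - lam k) => w l' l.
move: (z k.+2 - z k.+1) (z k.+1 - z k) (x k.+2 - x k.+1) (x k.+1 - x k).
move=> hz kz hx kx.
move: (A *m hx) (B *m hz) (B *m kz) (P *m hx) (Q *m hz) => a b b0 Phx Qhz.
move: (P *m (hx - kx)) (Q *m (hz - kz)) (hx - kx) (hz - kz) (l' - l) => ? ? ? ? ?.
rewrite !dotE (dotC b0 b).
by lra.
Qed.

(** Over the denominator [2 * rho] this is exactly the lower bound imposed on [d]. *)
Lemma dual_decrease_gt0 : 0 < 2 * d * beta - (alpha / rho - alpha * beta / 2).
Proof.
have -> : 2 * d * beta - (alpha / rho - alpha * beta / 2) =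
    (d * (4 * rho * beta) - (1 - rho * beta) * (2 - rho * beta)) / (2 * rho).
  by rewrite /alpha; field; rewrite gt_eqF.
by rewrite divr_gt0 ?subr_gt0 ?mulr_gt0.
Qed.

Lemma potential_decrease : exists2 e : R, 0 < e &
  forall k, potential k.+1 + e * step_sqr k.+1 <= potential k.
Proof.
have e0 := dual_decrease_gt0; set e1 := (2 * d * beta - _) in e0.
pose e := Num.min (LF / 2) (Num.min (LH / 2) e1).
have e_gt0 : 0 < e by rewrite !lt_min e0 !divr_gt0.
have [eF eH eL] : [/\ e <= LF / 2, e <= LH / 2 & e <= e1].
  by rewrite !ge_min !lexx !orbT.
exists e => // k; apply: le_trans (potential_step k); rewrite -/e1 /step_sqr.
have := ler_wpM2r (dot_ge0 (dx k.+1)) eF.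
have := ler_wpM2r (dot_ge0 (dz k.+1)) eH.
have := ler_wpM2r (dot_ge0 (dlam k.+1)) eL.
lra.
Qed.

Lemma potential_bounded_below : exists b, forall k, b <= potential k.
Proof.
have [bF hF] := F_bnd; have [bH hH] := H_bnd.
have [e e0 dec] := potential_decrease.
have a0 := alpha_gt0; have rho0 : rho != 0 by rewrite gt_eqF.
pose u k := alpha ^+ 2 / (2 * rho) * dot (lam k) (lam k).
have w0 : 0 <= alpha ^+ 2 / (2 * rho) by rewrite divr_ge0 ?sqr_ge0 ?mulr_ge0 // ltW.
have step_ge0 k : 0 <= step_sqr k by rewrite !addr_ge0 ?dot_ge0.
exists (bF + bH); apply: (@nonincreasing_telescope_ge _ potential u) => k.
- by apply: le_trans (dec k); rewrite lerDl mulr_ge0 // ltW.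
- by rewrite mulr_ge0 ?dot_ge0.
(* This rewrites the inner product of multiplier and residual as the increment of [u] plus
   nonnegative terms, among them [alpha * beta] times the squared multiplier, which outweighs the
   negative half in the potential. *)
have := dual_residual_telescope rho0 (lam_step k).
have := ler_fine_add (hF (x k.+1)) (x_subgradient k).1.
have := ler_fine_add (hH (z k.+1)) (z_subgradient k).1.
have d0 := ltW d_gt0.
have := mulr_ge0 w0 (dot_ge0 (dlam k)).
have ab : 0 <= alpha * beta by rewrite mulr_ge0 // ltW.
have := mulr_ge0 ab (dot_ge0 (lam k.+1)).
have := mulr_ge0 (ltW rho_gt0) (dot_ge0 (r k.+1)).
have aw0 : 0 <= d * (alpha / rho) by rewrite mulr_ge0 ?divr_ge0 // ltW.
have := mulr_ge0 aw0 (dot_ge0 (dlam k)).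
have := mulr_ge0 d0 (posdef_ge0 (dx k) P_posdef).
have := mulr_ge0 d0 (posdef_ge0 (dz k) Q_posdef).
have := mulr_ge0 (mulr_ge0 d0 (ltW LF_gt0)) (dot_ge0 (dx k)).
have := mulr_ge0 (mulr_ge0 d0 (ltW LH_gt0)) (dot_ge0 (dz k)).
have := mulr_ge0 (mulr_ge0 d0 (ltW rho_gt0)) (dot_ge0 (B *m dz k)).
rewrite /potential /u -/alpha -/P -/Q -/(dlam k).
move: (alpha / rho) (alpha ^+ 2 / (2 * rho)) => v w.
lra.
Qed.

Lemma small_step : exists C : R, forall K, (1 <= K)%N ->
  exists2 j, (1 <= j <= K)%N & K%:R * step_sqr j <= C.
Proof.
have [e e0 dec] := potential_decrease; have [b hb] := potential_bounded_below.
by exists ((potential 0%N - b) / e + 1) => K; exact: (descent_small_step e0 dec hb).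
Qed.

Lemma enorm_le_step k :
  [/\ enorm (dx k) <= Num.sqrt (step_sqr k), enorm (dz k) <= Num.sqrt (step_sqr k)
    & enorm (dlam k) <= Num.sqrt (step_sqr k)].
Proof.
have := (dot_ge0 (dx k), dot_ge0 (dz k), dot_ge0 (dlam k)) => -[[hx hz] hl].
by split; apply: ler_wsqrtr; rewrite /step_sqr; lra.
Qed.

(** The multiplier mismatch is [rho *: (B *m dz k)] for the [x] block and zero for the [z] block;
    every other error is linear in a single increment. *)
Lemma stationarity_le_step : exists2 C : R, 0 <= C & forall k,
  dual_stationary A B F0 F1 H0 H1 (C * Num.sqrt (step_sqr k))
    (x k.+1) (z k.+1) (lam k.+1) /\
  enorm (r k.+1 + beta *: lam k.+1) <= C * Num.sqrt (step_sqr k).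
Proof.
have [CP CP0 hP] := enorm_mulmx_le P; have [CQ CQ0 hQ] := enorm_mulmx_le Q.
have [CB CB0 hB] := enorm_mulmx_le (A^T *m (rho *: B)).
have a0 := alpha_gt0; have v0 : 0 <= alpha / rho by rewrite divr_ge0 // ltW.
exists (LF + LH + CP + CQ + CB + alpha / rho) => [|k].
  by rewrite !addr_ge0 // ltW.
have [hx hz hl] := enorm_le_step k.
move: (sqrtr_ge0 (step_sqr k)) hx hz hl; move: (Num.sqrt _) => s s0 hx hz hl.
have [LF0 LH0] := (ltW LF_gt0, ltW LH_gt0).
have := (mulr_ge0 LF0 s0, mulr_ge0 LH0 s0, mulr_ge0 CP0 s0, mulr_ge0 CQ0 s0,
  mulr_ge0 CB0 s0, mulr_ge0 v0 s0) => -[[[[[p1 p2] p3] p4] p5] p6].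
split; first split.
- apply: (block_dist_le F1_wcvx F0_lip (x_subgradient k)).
  rewrite (addrC (lam k.+1)) addrK scalemxAl mulmxA.
  have := hP (dx k); have := hB (dz k).
  have := ler_wpM2l LF0 hx; have := ler_wpM2l CP0 hx; have := ler_wpM2l CB0 hz.
  rewrite /dx /dz; lra.
- apply: (block_dist_le H1_wcvx H0_lip (z_subgradient k)).
  rewrite subrr mulmx0 (_ : enorm 0 = 0); last by apply/eqP; rewrite enorm0.
  have := hQ (dz k); have := ler_wpM2l LH0 hz; have := ler_wpM2l CQ0 hz.
  rewrite /dz; lra.
(* Solving the dual update for the residual shows that the perturbed residual is a multiple of the
   dual increment. *)
have -> : r k.+1 + beta *: lam k.+1 = - ((alpha / rho) *: dlam k).
  have -> : r k.+1 = rho^-1 *: (alpha *: lam k - lam k.+1).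
    by rewrite (lam_step k) opprB addrC subrK scalerA mulVf ?gt_eqF ?scale1r.
  rewrite /dlam /alpha; apply/matrixP => i j; rewrite !mxE; field.
  by rewrite gt_eqF.
rewrite enormN enormZ ger0_norm //; have := ler_wpM2l v0 hl; lra.
Qed.

End Iterates.

(** * From step size to the tolerance *)

Lemma dual_stationary_le (R : realType) n m p (A : 'M[R]_(p, n)) (B : 'M[R]_(p, m))
    F0 F1 H0 H1 e e' x z lam : e <= e' ->
  dual_stationary A B F0 F1 H0 H1 e x z lam ->
  dual_stationary A B F0 F1 H0 H1 e' x z lam.
Proof.
by move=> ee' [hx hz]; split; [apply: le_trans hx _|apply: le_trans hz _];
  rewrite lee_fin.
Qed.

(** Everything is multiplied by [q], the square root of [K - rho]: then [q * e <= zeta] because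
    [q ^+ 2 <= K], and [q * (beta * l)] is at most the root of [2 * Phat] because [beta * K = 1]
    turns [(K - rho) * beta ^+ 2] into [beta * (1 - rho * beta)]. *)
Lemma perturbed_tolerance (R : realType) (K rho beta zeta Phat eps e l : R) :
  0 < K -> 0 < eps -> 0 <= zeta -> 0 <= e -> 0 <= l -> 0 < rho -> rho * beta < 1 ->
  K * e ^+ 2 <= zeta ^+ 2 ->
  beta * (1 - rho * beta) / 2 * l ^+ 2 <= Phat -> beta = 1 / K ->
  K = (zeta + Num.sqrt (2 * Phat)) ^+ 2 / eps ^+ 2 + rho ->
  e + beta * l <= eps.
Proof.
move=> K0 eps0 zeta0 e0 l0 rho0 rb hK hP bE KE.
have b0 : 0 < beta by rewrite bE divr_gt0.
have bK : beta * K = 1 by rewrite bE divfK ?gt_eqF.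
have Kr : 0 < K - rho.
  rewrite -(pmulr_rgt0 _ b0) mulrBr bK subr_gt0 mulrC //.
have Phat0 : 0 <= 2 * Phat.
  rewrite mulr_ge0 //; apply: le_trans hP.
  by rewrite mulr_ge0 ?sqr_ge0 // divr_ge0 // mulr_ge0 ?subr_ge0 // ltW.
have : 0 <= Num.sqrt (2 * Phat) by exact: sqrtr_ge0.
have : Num.sqrt (2 * Phat) ^+ 2 = 2 * Phat by rewrite sqr_sqrtr.
move: (Num.sqrt (2 * Phat)) KE => s KE s2 s0.
have qE : (K - rho) * eps ^+ 2 = (zeta + s) ^+ 2.
  by rewrite KE addrK divfK // sqrf_eq0 gt_eqF.
have q2 : Num.sqrt (K - rho) ^+ 2 = K - rho by rewrite sqr_sqrtr // ltW.
have : 0 < Num.sqrt (K - rho) by rewrite sqrtr_gt0.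
move: (Num.sqrt (K - rho)) q2 => q q2 q0.
have qe : q * e <= zeta.
  rewrite -(ler_pXn2r (ltn0Sn 1)) ?nnegrE ?mulr_ge0 // ?(ltW q0) //.
  by rewrite exprMn q2; have := mulr_ge0 (ltW rho0) (sqr_ge0 e); lra.
have qw : q * (beta * l) <= s.
  rewrite -(ler_pXn2r (ltn0Sn 1)) ?nnegrE ?mulr_ge0 // ?(ltW q0) ?(ltW b0) //.
  rewrite !exprMn q2 s2.
  have -> : (K - rho) * (beta ^+ 2 * l ^+ 2) =
    2 * (beta * (beta * K - rho * beta) / 2 * l ^+ 2) by field.
  by rewrite bK ler_pM2l.
have qeps : q * eps = zeta + s.
  apply/eqP; rewrite -(@eqrXn2 _ 2) ?mulr_ge0 ?addr_ge0 // ?(ltW q0) ?(ltW eps0) //.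
  by rewrite exprMn q2 qE.
by rewrite -(ler_pM2l q0) mulrDr qeps lerD.
Qed.

Theorem theorem1 (R : realType) (n m p : nat)
  (A : 'M[R]_(p, n)) (B : 'M[R]_(p, m)) (c : 'cV[R]_p)
  (F0 : 'cV[R]_n -> R) (F1 : 'cV[R]_n -> \bar R)
  (H0 : 'cV[R]_m -> R) (H1 : 'cV[R]_m -> \bar R)
  (LF LH gammaF gammaH rho beta tauF tauH d : R)
  (hfeas : feasible A B c)
  (hstat : has_stationary_point A B c F0 F1 H0 H1)
  (hFbnd : bounded_below (fun x => (F0 x)%:E + F1 x)%E)
  (hHbnd : bounded_below (fun z => (H0 z)%:E + H1 z)%E)
  (hFcoer : coercive (fun x => (F0 x)%:E + F1 x)%E)
  (hHcoer : coercive (fun z => (H0 z)%:E + H1 z)%E)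
  (hLF : 0 < LF) (hLH : 0 < LH)
  (hF0 : lipschitz_gradient LF F0) (hH0 : lipschitz_gradient LH H0)
  (hF1 : [/\ proper_efun F1, closed_fun F1 & weakly_convex gammaF F1])
  (hH1 : [/\ proper_efun H1, closed_fun H1 & weakly_convex gammaH H1])
  (hrho : 0 < rho) (hbeta : 0 < beta)
  (hrhobeta : 0 < rho * beta < 1)
  (hd : 0 < (1 - rho * beta) * (2 - rho * beta) / (4 * rho * beta) < d)
  (htauF : mxsucc tauF%:M
     ((2 * d * rho) *: (A^T *m A)
      + ((4 * d + 3) * LF + (4 * d + 1) * gammaF)%:M))
  (htauH : mxsucc tauH%:M
     ((8 * d * rho) *: (B^T *m B)
      + ((4 * d + 3) * LH + (4 * d + 1) * gammaH)%:M))
  (htauFA : mxsucc tauF%:M (rho *: (A^T *m A)))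
  (htauHB : mxsucc tauH%:M (rho *: (B^T *m B)))
  (htauFgamma : gammaF < tauF) (htauHgamma : gammaH < tauH)
  (x : nat -> 'cV[R]_n) (z : nat -> 'cV[R]_m) (lam : nat -> 'cV[R]_p)
  (hseq : PPG_ADMM A B c F0 F1 H0 H1 rho beta tauF tauH x z lam) :
  exists zeta : R, 0 < zeta /\
    forall K : nat, (1 <= K)%N ->
      exists j : nat, (1 <= j <= K)%N /\
        forall eps : R, 0 < eps ->
          (K%:R = zeta ^+ 2 / eps ^+ 2 ->
             eps_AKKT A B c F0 F1 H0 H1 beta eps
               (x j.+1) (z j.+1) (lam j.+1)) /\
          (forall Phat : R,
             (forall k : nat,
                beta * (1 - rho * beta) / 2 * enorm (lam k) ^+ 2 <= Phat) ->
             beta = 1 / K%:R ->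
             K%:R = (zeta + Num.sqrt (2 * Phat)) ^+ 2 / eps ^+ 2 + rho ->
             eps_KKT A B c F0 F1 H0 H1 eps
               (x j.+1) (z j.+1) (lam j.+1)).
Proof.
have [F1p _ F1w] := hF1; have [H1p _ H1w] := hH1.
have rb1 : rho * beta < 1 by case/andP: hrhobeta.
have [d0 dlt] : 0 < d /\ (1 - rho * beta) * (2 - rho * beta) < d * (4 * rho * beta).
  case/andP: hd => hd0 hd1; split; first exact: lt_trans hd1.
  by rewrite -ltr_pdivrMr // !mulr_gt0.
have [C hC] := small_step hFbnd hHbnd hLF hLH hF0 hH0 F1p H1p F1w H1w hrho hbeta
  rb1 d0 dlt htauF htauH htauFA htauHB hseq.
have [C' C'0 hC'] := stationarity_le_step hLF hLH hF0 hH0 F1p H1p F1w H1w hrho rb1 hseq.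
have zeta0 : 0 <= C' * Num.sqrt C by rewrite mulr_ge0 ?sqrtr_ge0.
(* The added 1 keeps the constant positive even if [C'] or [C] vanishes. *)
exists (C' * Num.sqrt C + 1); split; first exact: ltr_wpDl.
move=> K K1; have [j jK hj] := hC K K1; exists j; split=> // eps eps0.
have [dj rj] := hC' j; have D0 : 0 <= step_sqr x z lam j by rewrite !addr_ge0 ?dot_ge0.
set e := C' * Num.sqrt _ in dj rj.
have e0 : 0 <= e by rewrite mulr_ge0 ?sqrtr_ge0.
have K0 : 0 < K%:R :> R by rewrite ltr0n.
have C0 : 0 <= C by apply: le_trans hj; rewrite mulr_ge0.
set zeta := _ + 1; have zeta1 : 0 <= zeta by rewrite addr_ge0.
have he : K%:R * e ^+ 2 <= zeta ^+ 2.
  rewrite /e exprMn sqr_sqrtr // mulrCA.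
  apply: le_trans (ler_wpM2l (sqr_ge0 C') hj) _.
  rewrite -[in X in X <= _](sqr_sqrtr C0) -exprMn ler_pXn2r ?nnegrE //.
  by rewrite lerDl.
split=> [KE|Phat hPhat bE KE].
  have ee : e <= eps.
    rewrite -(ler_pXn2r (ltn0Sn 1)) ?nnegrE ?(ltW eps0) // -(ler_pM2l K0).
    by rewrite {2}KE divfK // sqrf_eq0 gt_eqF.
  by split; [exact: dual_stationary_le ee dj|exact: le_trans ee].
have ee := perturbed_tolerance K0 eps0 zeta1 e0 (enorm_ge0 (lam j.+1)) hrho rb1 he
  (hPhat j.+1) bE KE.
split; first apply: dual_stationary_le dj.
  by apply: le_trans ee; rewrite lerDl mulr_ge0 ?enorm_ge0 // ltW.
apply: le_trans ee.
(* The true residual is the perturbed one minus [beta *: lam j.+1], whose size the dual bound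
   controls. *)
rewrite -(addrK (beta *: lam j.+1) (residual _ _ _ _ _)).
apply: le_trans (enorm_le_add _ _) _; apply: lerD => //.
by rewrite enormN enormZ gtr0_norm.
Qed.
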